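(* Let $A, B$ be $n\times n$ positive definite complex matrices. (1) For $t\in(0,1)$, $A\natural_t B\preceq A\diamond_t B$. (2) If $A\preceq B$, then for $t\in(1,\infty)$, $A\natural_t B\succeq A\diamond_t B$. (3) If $A\succeq B$, then for $t\in(-\infty,0)$, $A\natural_t B\succeq A\diamond_t B$. Moreover, in any of the three relations (for $t$, and $A,B$, as in the respective part), equality $A\natural_t B=A\diamond_t B$ holds if and only if $A=B$.
   Context: Positive definite means Hermitian positive definite. For positive definite $A,B$: $A\sharp B = A^{1/2}(A^{-1/2}BA^{-1/2})^{1/2}A^{1/2}$. For all $t\in\mathbb R$, $X\nabla_t Y=(1-t)X+tY$. The spectral geometric mean (extended to all $t\in\mathbb R$) is $A\natural_t B=(A^{-1}\sharp B)^tA(A^{-1}\sharp B)^t$. The Wasserstein mean (extended to all $t\in\mathbb R$) is $A\diamond_t B=(1-t)^2A+t^2B+t(1-t)[(AB)^{1/2}+(BA)^{1/2}]$, where the square roots are those with positive eigenvalues; equivalently $A\diamond_tB=[I\nabla_t(A^{-1}\sharp B)]A[I\nabla_t(A^{-1}\sharp B)]$. The near order $A\preceq B$ on positive definite matrices means $A^{-1}\sharp B\ge I$, where $\ge$ is the Löwner order; $A\succeq B$ means $B\preceq A$. *)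

(* Defs.v *)
From mathcomp Require Import all_boot all_order all_algebra.
From mathcomp Require Import sesquilinear spectral complex.
From mathcomp Require Import classical_sets reals exp.

Set Implicit Arguments.
Unset Strict Implicit.
Unset Printing Implicit Defensive.

Import Order.TTheory GRing.Theory Num.Theory.

Local Open Scope ring_scope.
Local Open Scope complex_scope.
Local Open Scope sesquilinear_scope.

Section MatrixMeans.
Context {R : realType} {n : nat}.
Implicit Types (A B X Y M : 'M[R[i]]_n) (t : R).

(* In R[i], 0 < z (resp. 0 <= z) means that z is real and positive
   (resp. nonnegative). *)
Definition posdefmx A : Prop :=
  A \is hermsymmx /\
  forall v : 'cV[R[i]]_n, v != 0 -> 0 < (v ^t* *m A *m v) 0 0.

Definition possemidefmx A : Prop :=
  A \is hermsymmx /\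
  forall v : 'cV[R[i]]_n, 0 <= (v ^t* *m A *m v) 0 0.

Definition loewner_le X Y : Prop := possemidefmx (Y - X).

(* Real powers by spectral calculus: for A Hermitian,
   A = P^-1 *m diag_mx d *m P with P := spectralmx A unitary and
   d := spectral_diag A real. Only meaningful for A positive definite. *)
Definition powmx A t : 'M[R[i]]_n :=
  invmx (spectralmx A)
    *m diag_mx (map_mx (fun z : R[i] => (powR (complex.Re z) t)%:C)
                       (spectral_diag A))
    *m spectralmx A.

(* The square root all of whose eigenvalues are positive. It exists and is
   unique when M is diagonalizable with positive eigenvalues, in particular
   when M is a product of two positive definite matrices, which need not be
   Hermitian. The value is 0 if there is no such square root. *)
Definition psqrtmx M : 'M[R[i]]_n :=
  xget 0 [set X : 'M[R[i]]_n |
           X *m X = M /\ (forall a : R[i], eigenvalue X a -> 0 < a)]%classic.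

Definition geomean A B : 'M[R[i]]_n :=
  powmx A 2^-1
    *m powmx (powmx A (- 2^-1) *m B *m powmx A (- 2^-1)) 2^-1
    *m powmx A 2^-1.

Definition spectral_geomean t A B : 'M[R[i]]_n :=
  powmx (geomean (invmx A) B) t *m A *m powmx (geomean (invmx A) B) t.

Definition wasserstein_mean t A B : 'M[R[i]]_n :=
  ((1 - t) ^+ 2)%:C *: A + (t ^+ 2)%:C *: B
  + (t * (1 - t))%:C *: (psqrtmx (A *m B) + psqrtmx (B *m A)).

(* The near order is a relation on positive definite matrices, so that both
   sides being positive definite is part of it. *)
Definition near_le A B : Prop :=
  [/\ posdefmx A, posdefmx B & loewner_le 1%:M (geomean (invmx A) B)].

Definition near_ge A B : Prop := near_le B A.

End MatrixMeans.

(* Main.v *)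
(* Let G = A^-1 # B, the unique positive definite solution of G A G = B. Since
   (A G)^2 = A B, the Wasserstein mean is H A H with H = (1 - t) + t G, while
   the spectral geometric mean is G^t A G^t. As H and G^t commute,
   Z = H G^-t is the positive definite solution of
   Z (G^t A G^t) Z = H A H, so the near order between the two means is the
   comparison of x^t with 1 - t + t x on the eigenvalues x of G, i.e.
   Bernoulli's inequality, which is strict for x <> 1. The hypotheses A <= B
   and A >= B in the near order say that all x >= 1, resp. all x <= 1, and make
   H positive definite for t > 1, resp. t < 0. *)
Require Import Defs.
From mathcomp Require Import all_boot all_order all_algebra.
From mathcomp Require Import complex reals.
From mathcomp Require Import sesquilinear spectral classical_sets sequences exp.
From mathcomp Require Import ring lra.

Import Order.TTheory GRing.Theory Num.Theory.

Local Open Scope ring_scope.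
Local Open Scope complex_scope.
Local Open Scope sesquilinear_scope.

(** * Strict Bernoulli inequalities for real powers, by range of the exponent *)

Section StrictBernoulli.
Set Implicit Arguments.
Unset Strict Implicit.
Context {R : realType}.
Implicit Types x t : R.

(** Put x = e^u with u <> 0. Factoring e^(ut) out of the right side leaves (1-t) e^(-ut) + t
    e^((1-t)u), and 1 + y < e^y for y <> 0 bounds this below by (1-t)(1-ut) + t(1+(1-t)u) = 1. *)
Lemma powR_lt_line x t : 0 < x -> x != 1 -> 0 < t < 1 ->
  powR x t < 1 - t + t * x.
Proof.
move=> x_gt0 x_neq1 /andP[t_gt0 t_lt1].
have [u ux] := expR_total x_gt0; subst x.
have u_neq0 : u != 0 by apply: contra_neq x_neq1 => ->; exact: expR0.
rewrite -expRM.
have e1 : expR (u * t) * expR (- (u * t)) = 1 by exact: expRxMexpNx_1.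
have e2 : expR (u * t) * expR ((1 - t) * u) = expR u.
  by rewrite -expRD; congr expR; ring.
have l1 : 1 + - (u * t) < expR (- (u * t)).
  by apply: expR_gt1Dx; rewrite oppr_eq0 mulf_neq0// gt_eqF.
have l2 : 1 + (1 - t) * u < expR ((1 - t) * u).
  by apply: expR_gt1Dx; rewrite mulf_neq0// subr_eq0 gt_eqF.
have -> : 1 - t + t * expR u =
    expR (u * t) * ((1 - t) * expR (- (u * t)) + t * expR ((1 - t) * u)).
  by rewrite mulrDr !(mulrCA (expR (u * t))) e1 e2 mulr1.
rewrite -[ltLHS]mulr1 ltr_pM2l ?expR_gt0//.
have : (1 - t) * (1 + - (u * t)) < (1 - t) * expR (- (u * t)).
  by rewrite ltr_pM2l// subr_gt0.
have : t * (1 + (1 - t) * u) < t * expR ((1 - t) * u) by rewrite ltr_pM2l.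
nra.
Qed.

(** The previous case, applied to the base x^t and the exponent 1/t, gives x < 1 - 1/t + x^t/t; then
    multiply by t. *)
Lemma line_lt_powR_gt1 x t : 0 < x -> x != 1 -> 1 < t ->
  1 - t + t * x < powR x t.
Proof.
move=> x_gt0 x_neq1 t_gt1.
have := @powR_lt_line (powR x t) t^-1 (powR_gt0 _ x_gt0).
have t_gt0 : 0 < t by lra.
have tn0 : t != 0 by rewrite gt_eqF.
rewrite powR_eq1 (negPf x_neq1) (negPf tn0) !orbF ltNge (ltW x_gt0) /=.
rewrite invr_gt0 t_gt0 invf_lt1// t_gt1 => /(_ isT isT).
rewrite -powRrM mulfV// powRr1 ?ltW// -(ltr_pM2l t_gt0).
by rewrite mulrDr mulrBr mulr1 mulfV// mulVKf//; lra.
Qed.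

(** With x = e^u, the tangent bound 1 + y < e^y is used at y = ut and at y = u; multiplying the
    latter by t < 0 reverses it, so both meet at 1 + ut. *)
Lemma line_lt_powR_lt0 x t : 0 < x -> x != 1 -> t < 0 ->
  1 - t + t * x < powR x t.
Proof.
move=> x_gt0 x_neq1 t_lt0.
have [u ux] := expR_total x_gt0; subst x.
have u_neq0 : u != 0 by apply: contra_neq x_neq1 => ->; exact: expR0.
rewrite -expRM.
have : 1 + u * t < expR (u * t).
  by apply: expR_gt1Dx; rewrite mulf_neq0// lt_eqF.
have : t * expR u < t * (1 + u) by rewrite ltr_nM2l// expR_gt1Dx.
nra.
Qed.

End StrictBernoulli.

(** * Algebra of matrices diagonalised by a common invertible matrix *)

Section ConjugateDiagonal.
Set Implicit Arguments.
Unset Strict Implicit.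
Context {F : comUnitRingType} {n : nat}.
Implicit Types (P : 'M[F]_n) (D E : 'rV[F]_n).

Definition conjdiag P D : 'M[F]_n := invmx P *m diag_mx D *m P.

Lemma conjdiagM P D E : P \in unitmx ->
  conjdiag P D *m conjdiag P E = conjdiag P (\row_i (D 0 i * E 0 i)).
Proof.
move=> uP; rewrite /conjdiag !mulmxA mulmxK//.
by rewrite -(mulmxA _ (diag_mx D)) mulmx_diag.
Qed.

Lemma conjdiagD P D E : conjdiag P D + conjdiag P E = conjdiag P (D + E).
Proof. by rewrite /conjdiag -mulmxDl -mulmxDr -raddfD. Qed.

Lemma conjdiag_const P (c : F) : P \in unitmx ->
  conjdiag P (const_mx c) = c%:M.
Proof.
move=> uP; rewrite /conjdiag diag_const_mx mul_mx_scalar -scalemxAl mulVmx//.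
by rewrite scalemx1.
Qed.

Lemma conjdiag_inj P : P \in unitmx -> injective (conjdiag P).
Proof.
move=> uP D E /(congr1 (fun M => P *m M *m invmx P)).
rewrite /conjdiag !mulmxA !mulmxV// !mul1mx !mulmxK// => DE.
by apply/rowP => i; have /matrixP/(_ i i) := DE; rewrite !mxE eqxx.
Qed.

(** S^2 A = S (S A S) S^-1 is similar to S A S, so the diagonalising matrix P of the latter becomes
    P S^-1. *)
Lemma conjdiag_sandwich P D (A S : 'M[F]_n) : P \in unitmx -> S \in unitmx ->
  S *m A *m S = conjdiag P D ->
  P *m invmx S *m (S *m S *m A) = diag_mx D *m (P *m invmx S).
Proof.
move=> uP uS SAS; have -> : diag_mx D = P *m (S *m A *m S) *m invmx P.
  by rewrite SAS /conjdiag !mulmxA mulmxV// mul1mx mulmxK.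
by rewrite !mulmxA (mulmxKV uP) (mulmxK uS) (mulmxKV uS).
Qed.

(** For a = 1 - t and b = t this links the factored form of the Wasserstein mean to its defining
    sum. *)
Lemma mulmx_affine_sandwich (A G : 'M[F]_n) (a b : F) :
  (a%:M + b *: G) *m A *m (a%:M + b *: G) =
  (a ^+ 2) *: A + (b ^+ 2) *: (G *m A *m G) + (b * a) *: (A *m G + G *m A).
Proof.
rewrite mulmxDl mulmxDr !mulmxDl !mul_scalar_mx !mul_mx_scalar -!scalemxAr.
rewrite -!scalemxAl !scalerA scalerDr -!expr2 (mulrC a b).
rewrite [X in _ + X = _]addrC addrACA.
by rewrite [X in _ + X = _]addrC.
Qed.

End ConjugateDiagonal.

(** * Hermitian forms of unitarily diagonalised matrices *)

Section UnitaryConjugateDiagonal.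
Set Implicit Arguments.
Unset Strict Implicit.
Context {C : numClosedFieldType} {n : nat}.
Implicit Types (M P : 'M[C]_n) (D : 'rV[C]_n).

Lemma hermsymmxP M : M \is hermsymmx <-> M ^t* = M.
Proof.
split=> [/is_hermitianmxP|h]; first by rewrite expr0 scale1r => <-.
by apply/is_hermitianmxP; rewrite expr0 scale1r.
Qed.

Lemma trmxC_mul m p q (M : 'M[C]_(m, p)) (N : 'M[C]_(p, q)) :
  (M *m N) ^t* = N ^t* *m M ^t*.
Proof. by rewrite trmx_mul map_mxM. Qed.

Lemma conjdiag_form P D (v : 'cV[C]_n) : P \is unitarymx ->
  (v ^t* *m conjdiag P D *m v) 0 0 = \sum_i D 0 i * `|(P *m v) i 0| ^+ 2.
Proof.
move=> uP; rewrite /conjdiag invmx_unitary// !mulmxA -trmxC_mul.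
rewrite -mulmxA mul_mx_diag; move: (P *m v) => w; rewrite mxE.
by apply: eq_bigr => i _; rewrite !mxE normCK; ring.
Qed.

Lemma conjdiag_herm P D : P \is unitarymx -> D \is a realmx ->
  conjdiag P D \is hermsymmx.
Proof.
move=> uP rD; apply/hermsymmxP; rewrite /conjdiag invmx_unitary//.
by rewrite !trmxC_mul trmxCK tr_diag_mx map_diag_mx mulmxA (realmxC rD).
Qed.

Lemma hermsymmx_congr M (S : 'M[C]_n) :
  M \is hermsymmx -> S ^t* *m M *m S \is hermsymmx.
Proof.
by move=> /hermsymmxP hM; apply/hermsymmxP; rewrite !trmxC_mul trmxCK hM mulmxA.
Qed.

End UnitaryConjugateDiagonal.


(** * Positive definite matrices, their spectral calculus and real powers *)

Section PositiveDefinite.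
Set Implicit Arguments.
Unset Strict Implicit.
Context {R : realType} {n : nat}.
Implicit Types (A B G X Y M P S : 'M[R[i]]_n) (d e : 'I_n -> R) (s t : R).

Lemma posdefmx_congr A S :
  posdefmx A -> S \in unitmx -> posdefmx (S ^t* *m A *m S).
Proof.
move=> [hA pA] uS; split=> [|v v0]; first exact: hermsymmx_congr.
have := pA (S *m v); rewrite trmxC_mul !mulmxA; apply.
by apply: contra_neq v0 => /(congr1 (mulmx (invmx S))); rewrite mulKmx// mulmx0.
Qed.

Definition realdiag d : 'rV[R[i]]_n := \row_i (d i)%:C.

Lemma realdiag_real d : realdiag d \is a realmx.
Proof.
by apply/mxOverP => i j; rewrite mxE; apply/complex_realP; exists (d j).
Qed.

(** With P fixed, varying [d] gives all functions of one Hermitian matrix: they commute, and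
    identities between them reduce to real identities on eigenvalues. *)
Definition spectral_calculus P d : 'M[R[i]]_n := conjdiag P (realdiag d).

Lemma eq_spectral_calculus P d e : d =1 e ->
  spectral_calculus P d = spectral_calculus P e.
Proof.
by move=> de; apply: (congr1 (conjdiag P)); apply/rowP => i; rewrite !mxE de.
Qed.

Lemma spectral_calculusM P d e : P \in unitmx ->
  spectral_calculus P d *m spectral_calculus P e =
  spectral_calculus P (fun i => d i * e i).
Proof.
move=> uP; rewrite /spectral_calculus (conjdiagM _ _ uP); apply: (congr1 (conjdiag P)).
by apply/rowP => i; rewrite !mxE -rmorphM.
Qed.

Lemma spectral_calculusD P d e :
  spectral_calculus P d + spectral_calculus P e =
  spectral_calculus P (fun i => d i + e i).
Proof.
rewrite /spectral_calculus conjdiagD; apply: (congr1 (conjdiag P)).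
by apply/rowP => i; rewrite !mxE -rmorphD.
Qed.

Lemma spectral_calculus_const P (c : R) : P \in unitmx ->
  spectral_calculus P (fun=> c) = (c%:C)%:M.
Proof.
move=> uP; rewrite -(conjdiag_const _ uP); apply: (congr1 (conjdiag P)).
by apply/rowP => i; rewrite !mxE.
Qed.

Lemma spectral_calculusZ P (c : R) d : P \in unitmx ->
  c%:C *: spectral_calculus P d = spectral_calculus P (fun i => c * d i).
Proof.
move=> uP.
by rewrite -(spectral_calculusM (fun=> c) d uP) (spectral_calculus_const c uP)
  mul_scalar_mx.
Qed.

Lemma spectral_calculus_inj P d e : P \in unitmx ->
  spectral_calculus P d = spectral_calculus P e -> d =1 e.
Proof.
move=> uP /(conjdiag_inj uP) /rowP de i.
by have := de i; rewrite !mxE => /complexI.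
Qed.

(** The test vector [v] is the i-th eigenvector, so a sign condition on the form passes to each
    diagonal entry. *)
Lemma conjdiag_form_delta P D i (v := invmx P *m delta_mx i 0 : 'cV[R[i]]_n) :
  P \is unitarymx -> (v ^t* *m conjdiag P D *m v) 0 0 = D 0 i.
Proof.
move=> uP; rewrite conjdiag_form// mulKVmx ?unitarymx_unit//.
rewrite (bigD1 i)//= big1 => [|j ji]; rewrite mxE.
  by rewrite !eqxx normr1 expr1n mulr1 addr0.
by rewrite (negPf ji) normr0 expr0n mulr0.
Qed.

Lemma spectral_calculus_posdefP P d : P \is unitarymx ->
  posdefmx (spectral_calculus P d) <-> forall i, 0 < d i.
Proof.
move=> uP; have uP' := unitarymx_unit uP; split=> [[_ pos] i|d_gt0].
  have := pos (invmx P *m delta_mx i 0).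
  rewrite conjdiag_form_delta// mxE ltcR; apply.
  apply/eqP => /(congr1 (mulmx P)); rewrite mulKVmx// mulmx0.
  by move=> /matrixP/(_ i 0); rewrite !mxE !eqxx; apply/eqP/oner_neq0.
split=> [|v v0]; first by apply: conjdiag_herm => //; exact: realdiag_real.
rewrite conjdiag_form//.
have ge0 i : true -> 0 <= realdiag d 0 i * `|(P *m v) i 0| ^+ 2.
  by move=> _; rewrite mulr_ge0 ?exprn_ge0// mxE lecR ltW.
(* A sum of nonnegative terms vanishes only termwise, which would force P v = 0 and hence v = 0. *)
rewrite lt0r sumr_ge0// andbT psumr_eq0//.
apply: contra_neqN v0 => /allP Pv0.
suff : P *m v = 0.
  by move=> /(congr1 (mulmx (invmx P))); rewrite mulKmx// mulmx0.
apply/matrixP => i j; rewrite (ord1 j) [RHS]mxE.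
have := Pv0 i (mem_index_enum i).
rewrite mulf_eq0 expf_eq0 normr_eq0 /= => /orP[|/eqP//].
by rewrite mxE; have := d_gt0 i; rewrite -ltcR => /gt_eqF ->.
Qed.

Lemma spectral_calculus_possemidefP P d : P \is unitarymx ->
  possemidefmx (spectral_calculus P d) <-> forall i, 0 <= d i.
Proof.
move=> uP; split=> [[_ pos] i|d_ge0].
  have := pos (invmx P *m delta_mx i 0).
  by rewrite conjdiag_form_delta// mxE lecR.
split=> [|v]; first by apply: conjdiag_herm => //; exact: realdiag_real.
rewrite conjdiag_form// sumr_ge0// => i _.
by rewrite mulr_ge0 ?exprn_ge0// mxE lecR.
Qed.

(** One real family [d] serves A and all its powers; taking real parts loses nothing, as a Hermitian
    matrix has a real spectrum. *)
Lemma posdefmx_spectral A : posdefmx A -> exists d,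
  [/\ forall i, 0 < d i, A = spectral_calculus (spectralmx A) d &
      forall t, powmx A t =
        spectral_calculus (spectralmx A) (fun i => powR (d i) t)].
Proof.
move=> pA; have [hA _] := pA.
pose d i := complex.Re (spectral_diag A 0 i).
have dE : realdiag d = spectral_diag A.
  apply/rowP => i; rewrite mxE RRe_real//.
  by have /mxOverP := hermitian_spectral_diag_real hA; apply.
have AE : A = spectral_calculus (spectralmx A) d.
  by rewrite /spectral_calculus dE; exact/orthomx_spectralP/hermitian_normalmx.
exists d; split; [|exact: AE|move=> t].
  apply/(spectral_calculus_posdefP _ (spectral_unitarymx A)).
  by rewrite -AE.
by apply: (congr1 (conjdiag _)); apply/rowP => i; rewrite !mxE.
Qed.

Lemma powmx_posdef A t : posdefmx A -> posdefmx (powmx A t).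
Proof.
move=> /posdefmx_spectral[d [d_gt0 _ ->]].
apply/spectral_calculus_posdefP; first exact: spectral_unitarymx.
by move=> i; rewrite powR_gt0.
Qed.

Lemma powmxD A s t : posdefmx A -> powmx A s *m powmx A t = powmx A (s + t).
Proof.
move=> /posdefmx_spectral[d [d_gt0 _ pE]].
rewrite !pE (spectral_calculusM _ _ (spectral_unit A)).
apply: eq_spectral_calculus => i; rewrite powRD//.
by apply/implyP => _; rewrite gt_eqF.
Qed.

Lemma powmx1 A : posdefmx A -> powmx A 1 = A.
Proof.
move=> /posdefmx_spectral[d [d_gt0 AE pE]].
by rewrite pE [RHS]AE; apply: eq_spectral_calculus => i; rewrite powRr1 ?ltW.
Qed.

Lemma powmx0 A : posdefmx A -> powmx A 0 = 1%:M.
Proof.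
move=> /posdefmx_spectral[d [d_gt0 AE pE]].
rewrite pE -[RHS](spectral_calculus_const 1 (spectral_unit A)).
by apply: eq_spectral_calculus => i; rewrite powRr0.
Qed.

Lemma posdefmx_unit A : posdefmx A -> A \in unitmx.
Proof.
move=> pA; suff /mulmx1_unit[]// : powmx A 1 *m powmx A (-1) = 1%:M.
  by rewrite (powmx1 pA).
by rewrite (powmxD _ _ pA) subrr (powmx0 pA).
Qed.

Lemma powmxN A t : posdefmx A -> powmx A (- t) = invmx (powmx A t).
Proof.
move=> pA; have uAt := posdefmx_unit (powmx_posdef t pA).
by rewrite -[LHS](mulKmx uAt) (powmxD _ _ pA) subrr (powmx0 pA) mulmx1.
Qed.

Lemma invmx_posdef A : posdefmx A -> posdefmx (invmx A).
Proof. by move=> pA; rewrite -(powmx1 pA) -(powmxN _ pA); exact: powmx_posdef. Qed.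

Lemma posdefmx_herm A : posdefmx A -> A ^t* = A.
Proof. by case=> /hermsymmxP. Qed.

Lemma posdefmx_sandwich A S : posdefmx A -> posdefmx S -> posdefmx (S *m A *m S).
Proof.
move=> pA pS; rewrite -{1}(posdefmx_herm pS).
by apply: posdefmx_congr => //; exact: posdefmx_unit.
Qed.

Lemma powmx_half A : posdefmx A -> powmx A 2^-1 *m powmx A 2^-1 = A.
Proof.
move=> pA; rewrite (powmxD _ _ pA) -[RHS](powmx1 pA); apply: (congr1 (powmx A)); lra.
Qed.

(** * The geometric mean and its Riccati equation *)

Lemma geomean_posdef A B : posdefmx A -> posdefmx B -> posdefmx (geomean A B).
Proof.
move=> pA pB; have pS t := powmx_posdef t pA.
exact/posdefmx_sandwich/(pS _)/powmx_posdef/posdefmx_sandwich/(pS _).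
Qed.

(** With S = A^(1/2) and W = (S^-1 B S^-1)^(1/2), the inner S A^-1 S is the identity, leaving S W^2
    S = B. *)
Lemma geomean_riccati A B : posdefmx A -> posdefmx B ->
  geomean A B *m invmx A *m geomean A B = B.
Proof.
move=> pA pB; rewrite /geomean (powmxN _ pA).
have uS := posdefmx_unit (powmx_posdef 2^-1 pA).
have pSBS : posdefmx (invmx (powmx A 2^-1) *m B *m invmx (powmx A 2^-1)).
  by apply: posdefmx_sandwich pB _; apply/invmx_posdef/powmx_posdef.
have := powmx_half pSBS; set W := powmx (_ *m _ *m _) _.
have := powmx_half pA; move: (powmx A 2^-1) uS W => S uS W SS WW.
have SAS : S *m invmx A *m S = 1%:M.
  (* For square matrices a one-sided inverse is two-sided, so A^-1 S S = 1 can be rotated into S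
     A^-1 S = 1. *)
  by rewrite -mulmxA; apply: mulmx1C; rewrite -mulmxA SS mulVmx// posdefmx_unit.
have -> : S *m W *m S *m invmx A *m (S *m W *m S) =
    S *m (W *m (S *m invmx A *m S) *m W) *m S by rewrite !mulmxA.
by rewrite SAS mulmx1 WW !mulmxA (mulmxV uS) mul1mx (mulmxKV uS).
Qed.

(** * Positive square roots of products, and uniqueness in the Riccati equation *)

Lemma posdef_mul_diag G A : posdefmx G -> posdefmx A -> exists T d,
  [/\ T \in unitmx, forall i, 0 < d i &
      T *m (G *m A) = diag_mx (realdiag d) *m T].
Proof.
move=> pG pA; have pS := powmx_posdef 2^-1 pG.
have := powmx_half pG; move: (powmx G 2^-1) pS => S pS SS.
have uS := posdefmx_unit pS.
have pSAS := posdefmx_sandwich pA pS.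
have [d [d_gt0 SAS _]] := posdefmx_spectral pSAS.
have uP := spectral_unit (S *m A *m S); move: (spectralmx _) uP SAS => P uP SAS.
(* G A = S^2 A is similar to the positive definite S A S, which P diagonalises. *)
exists (P *m invmx S), d; split; [|exact: d_gt0|].
  by rewrite unitmx_mul uP unitmx_inv uS.
by rewrite -SS; exact: conjdiag_sandwich.
Qed.

(** A left eigenvector v of M yields the left eigenvector v T^-1 of the diagonal matrix; any nonzero
    coordinate of it identifies [a] with an entry of [d]. *)
Lemma diag_eigenvalue_gt0 M T d a :
  T \in unitmx -> (forall i, 0 < d i) -> T *m M = diag_mx (realdiag d) *m T ->
  eigenvalue M a -> 0 < a.
Proof.
move=> uT d_gt0 TM /eigenvalueP[v vM v0].
have vE : v = v *m invmx T *m T by rewrite mulmxKV.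
have w0 : v *m invmx T != 0 by apply: contra_neq v0 => w0; rewrite vE w0 mul0mx.
move: (v *m invmx T) w0 vE => w w0 vE.
have [i wi0] := rV0Pn _ w0.
have /rowP/(_ i) : w *m diag_mx (realdiag d) = a *: w.
  apply: (can_inj (mulmxK uT)).
  by rewrite -mulmxA -TM mulmxA -vE vM -scalemxAl -vE.
rewrite mul_mx_diag !mxE mulrC => /(mulIf wi0) <-.
by rewrite ltcR.
Qed.

(* [Y D = - D X] for [D = X - Y], so [D] would map an eigenvector of [Y] to an
   eigenvector of [X] for the opposite, hence negative, eigenvalue. *)
Lemma sqr_eq_posdiag X Y T d :
  (forall a, eigenvalue X a -> 0 < a) ->
  T \in unitmx -> (forall i, 0 < d i) -> T *m Y = diag_mx (realdiag d) *m T ->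
  X *m X = Y *m Y -> X = Y.
Proof.
move=> eX uT d_gt0 TY XY.
suff /(congr1 (mulmx (invmx T))) : T *m (X - Y) = 0.
  by rewrite mulKmx// mulmx0 => /eqP; rewrite subr_eq0 => /eqP.
apply/row_matrixP => i; rewrite row0 row_mul; apply/eqP/negPn/negP => nz.
have YD : Y *m (X - Y) = - ((X - Y) *m X).
  by rewrite mulmxBr mulmxBl XY opprB.
have TYi : row i T *m Y = (d i)%:C *: row i T.
  rewrite -row_mul TY mul_diag_mx; apply/rowP => j.
  by rewrite !mxE.
suff /eX : eigenvalue X (- d i)%:C.
  by rewrite ltcR oppr_gt0 ltNge ltW.
apply/eigenvalueP; exists (row i T *m (X - Y)); last by [].
apply: oppr_inj; rewrite rmorphN scaleNr opprK -mulmxA -mulmxN -YD.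
by rewrite mulmxA TYi scalemxAl.
Qed.

(** G A is diagonalisable with positive eigenvalues, so it is an admissible root and the only one;
    the default 0 of [xget] is never reached. *)
Lemma psqrtmx_posdefM G A : posdefmx G -> posdefmx A ->
  psqrtmx (G *m A *m (G *m A)) = G *m A.
Proof.
move=> pG pA; have [T [d [uT d_gt0 TGA]]] := posdef_mul_diag pG pA.
apply: xget_unique => [|Y [YY eY]].
  by split=> // a; exact: diag_eigenvalue_gt0 TGA.
exact: sqr_eq_posdiag TGA _.
Qed.

(** Multiplied by A on the right, the equation reads (X A)^2 = (Y A)^2. Both sides have a unique
    positive root, so X A = Y A. *)
Lemma riccati_inj A X Y : posdefmx A -> posdefmx X -> posdefmx Y ->
  X *m A *m X = Y *m A *m Y -> X = Y.
Proof.
move=> pA pX pY XY; apply: (can_inj (mulmxK (posdefmx_unit pA))).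
rewrite -(psqrtmx_posdefM pX pA) -(psqrtmx_posdefM pY pA).
by rewrite !mulmxA XY.
Qed.

Lemma geomean_unique A X : posdefmx A -> posdefmx X ->
  geomean (invmx A) (X *m A *m X) = X.
Proof.
move=> pA pX; have pA' := invmx_posdef pA.
have pB := posdefmx_sandwich pA pX.
have := geomean_riccati pA' pB; rewrite invmxK.
apply: (riccati_inj pA _ pX); exact: geomean_posdef.
Qed.

(** * Equality and near order between sandwiches of A *)

Lemma sandwich_inj A P d e : posdefmx A -> P \is unitarymx ->
  (forall i, 0 < d i) -> (forall i, 0 < e i) ->
  spectral_calculus P d *m A *m spectral_calculus P d =
    spectral_calculus P e *m A *m spectral_calculus P e <-> d =1 e.
Proof.
move=> pA uP d_gt0 e_gt0; split=> [|/(eq_spectral_calculus P) ->]; last exact: erefl.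
move=> /(riccati_inj pA) de.
apply: (spectral_calculus_inj (unitarymx_unit uP)).
by apply: de; apply/(spectral_calculus_posdefP _ uP).
Qed.

(** The two factorisations of E give E A E = F (D A D) F, so by uniqueness F is the geometric mean
    of (D A D)^-1 and E A E. *)
Lemma near_le_sandwich A D E F : posdefmx A -> posdefmx D -> posdefmx F ->
  E = F *m D -> E = D *m F ->
  near_le (D *m A *m D) (E *m A *m E) <-> possemidefmx (F - 1%:M).
Proof.
move=> pA pD pF EFD EDF; have pX := posdefmx_sandwich pA pD.
have -> : E *m A *m E = F *m (D *m A *m D) *m F.
  by rewrite {1}EFD EDF !mulmxA.
have pY := posdefmx_sandwich pX pF.
by rewrite /near_le /loewner_le (geomean_unique pX pF); split=> [[]|].
Qed.

Lemma near_le_spectral A P d e : posdefmx A -> P \is unitarymx ->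
  (forall i, 0 < d i) -> (forall i, 0 < e i) ->
  near_le (spectral_calculus P d *m A *m spectral_calculus P d)
          (spectral_calculus P e *m A *m spectral_calculus P e) <->
  forall i, d i <= e i.
Proof.
move=> pA uP d_gt0 e_gt0; have uP' := unitarymx_unit uP.
(* The eigenvalues of the F carrying one sandwich to the other; F >= 1 then means d <= e
   entrywise. *)
pose f i := e i / d i.
have pd : posdefmx (spectral_calculus P d) by apply/(spectral_calculus_posdefP _ uP).
have pf : posdefmx (spectral_calculus P f).
  by apply/(spectral_calculus_posdefP _ uP) => i; rewrite divr_gt0.
have fd : spectral_calculus P e = spectral_calculus P f *m spectral_calculus P d.
  rewrite (spectral_calculusM _ _ uP'); apply: eq_spectral_calculus => i.
  by rewrite mulfVK ?gt_eqF.
have df : spectral_calculus P e = spectral_calculus P d *m spectral_calculus P f.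
  rewrite (spectral_calculusM _ _ uP'); apply: eq_spectral_calculus => i.
  by rewrite mulrC mulfVK ?gt_eqF.
have f1 : spectral_calculus P f - 1%:M = spectral_calculus P (fun i => f i + -1).
  rewrite -spectral_calculusD (spectral_calculus_const (-1) uP').
  by rewrite rmorphN1 raddfN.
have fE i : (0 <= f i + -1) = (d i <= e i).
  by rewrite /f subr_ge0 (ler_pdivlMr _ _ (d_gt0 i)) mul1r.
apply: (iff_trans (near_le_sandwich pA pd pf fd df)); rewrite f1.
apply: (iff_trans (spectral_calculus_possemidefP _ uP)).
by split=> h i; have := h i; rewrite fE.
Qed.

(** * Both means as sandwiches of A by functions of G *)

Lemma wasserstein_mean_sandwich A G t (H := ((1 - t)%:C)%:M + t%:C *: G) :
  posdefmx A -> posdefmx G ->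
  wasserstein_mean t A (G *m A *m G) = H *m A *m H.
Proof.
move=> pA pG; rewrite /wasserstein_mean.
(* For B = G A G, both A B and B A are squares, with positive roots A G and G A. *)
have -> : A *m (G *m A *m G) = A *m G *m (A *m G) by rewrite !mulmxA.
have -> : G *m A *m G *m A = G *m A *m (G *m A) by rewrite !mulmxA.
rewrite (psqrtmx_posdefM pA pG) (psqrtmx_posdefM pG pA) /H.
by rewrite mulmx_affine_sandwich -!rmorphXn -rmorphM.
Qed.

Lemma means_spectral A B : posdefmx A -> posdefmx B -> exists P d,
  [/\ P \is unitarymx, forall i, 0 < d i,
      B = spectral_calculus P d *m A *m spectral_calculus P d,
      forall t (S := spectral_calculus P (fun i => powR (d i) t)),
        spectral_geomean t A B = S *m A *m S &
      forall t (H := spectral_calculus P (fun i => 1 - t + t * d i)),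
        wasserstein_mean t A B = H *m A *m H].
Proof.
move=> pA pB; pose G := geomean (invmx A) B.
have pG : posdefmx G by apply: geomean_posdef pB; exact: invmx_posdef.
have BE : G *m A *m G = B.
  by have := geomean_riccati (invmx_posdef pA) pB; rewrite invmxK.
have [d [d_gt0 GE GtE]] := posdefmx_spectral pG.
exists (spectralmx G), d; split; [exact: spectral_unitarymx|exact: d_gt0| | |].
- by rewrite -GE BE.
- by move=> t S; rewrite /spectral_geomean -/G GtE.
move=> t H; rewrite -{1}BE (wasserstein_mean_sandwich _ pA pG).
suff -> : ((1 - t)%:C)%:M + t%:C *: G = H by [].
have uP := spectral_unit G.
rewrite -(spectral_calculus_const (1 - t) uP) [in X in _ + X]GE.
by rewrite (spectral_calculusZ _ _ uP); exact: spectral_calculusD.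
Qed.

End PositiveDefinite.

Theorem theorem3p1 (R : realType) (n : nat) (A B : 'M[R[i]]_n)
    (hA : posdefmx A) (hB : posdefmx B) :
  [/\ forall t : R, 0 < t < 1 ->
        near_le (spectral_geomean t A B) (wasserstein_mean t A B) /\
        (spectral_geomean t A B = wasserstein_mean t A B <-> A = B),
      near_le A B -> forall t : R, 1 < t ->
        near_ge (spectral_geomean t A B) (wasserstein_mean t A B) /\
        (spectral_geomean t A B = wasserstein_mean t A B <-> A = B)
    & near_ge A B -> forall t : R, t < 0 ->
        near_ge (spectral_geomean t A B) (wasserstein_mean t A B) /\
        (spectral_geomean t A B = wasserstein_mean t A B <-> A = B)].
Proof.
have [P [d [uP d_gt0 BE XE YE]]] := means_spectral hA hB.
(* Seen as a sandwich with eigenvalues 1, A can be compared with B by the same lemmas as the two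
   means. *)
have AE : A = spectral_calculus P (fun=> 1) *m A *m spectral_calculus P (fun=> 1).
  by rewrite (spectral_calculus_const 1 (unitarymx_unit uP)) mul1mx mulmx1.
have one_gt0 (i : 'I_n) : 0 < 1 :> R by [].
have pow_gt0 t i : 0 < powR (d i) t by rewrite powR_gt0.
have eqAB : A = B <-> (fun=> 1) =1 d.
  by rewrite {1}AE BE; exact: sandwich_inj.
have eq_means (t : R) : (forall i, 0 < 1 - t + t * d i) ->
    (forall i, d i != 1 -> powR (d i) t != 1 - t + t * d i) ->
    spectral_geomean t A B = wasserstein_mean t A B <-> A = B.
  move=> line_gt0 neq; rewrite eqAB XE YE (sandwich_inj hA uP (pow_gt0 t) line_gt0).
  split=> h i; last by rewrite -(h i) powR1; ring.
  (* Strictness away from 1 makes equality of the means force every eigenvalue of G to be 1. *)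
  apply/esym/eqP; apply: contra_eqT (h i); exact: neq.
have le_means (t : R) : (forall i, 0 < 1 - t + t * d i) ->
    near_le (spectral_geomean t A B) (wasserstein_mean t A B) <->
    forall i, powR (d i) t <= 1 - t + t * d i.
  by move=> line_gt0; rewrite XE YE; exact: near_le_spectral.
have ge_means (t : R) : (forall i, 0 < 1 - t + t * d i) ->
    near_ge (spectral_geomean t A B) (wasserstein_mean t A B) <->
    forall i, 1 - t + t * d i <= powR (d i) t.
  by move=> line_gt0; rewrite XE YE; exact: near_le_spectral.
(* In this form, positivity for t outside [0, 1] follows once t and [d i - 1] have compatible signs,
   which the near order between A and B supplies. *)
have lineE (t : R) i : 1 - t + t * d i = 1 + t * (d i - 1) by ring.
have pow1 (t : R) i : d i = 1 -> powR (d i) t = 1 - t + t * d i.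
  by move=> ->; rewrite powR1; ring.
split=> [t /andP[t_gt0 t_lt1]|leAB t t_gt1|geAB t t_lt0].
- have line_gt0 i : 0 < 1 - t + t * d i.
    by rewrite addr_gt0 ?mulr_gt0// subr_gt0.
  have lt i : d i != 1 -> powR (d i) t < 1 - t + t * d i.
    by move=> d1; apply: powR_lt_line => //; apply/andP.
  split; last by apply: eq_means => // i /lt/lt_eqF ->.
  by apply/le_means => // i; have [/pow1 ->//|/lt/ltW//] := eqVneq (d i) 1.
- have t_ge0 : 0 <= t := ltW (lt_trans ltr01 t_gt1).
  have d_ge1 : forall i, 1 <= d i.
    by move: leAB; rewrite {1}AE BE => /(near_le_spectral hA uP one_gt0 d_gt0).
  have line_gt0 i : 0 < 1 - t + t * d i.
    by rewrite lineE ltr_wpDr// mulr_ge0// subr_ge0.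
  have lt i : d i != 1 -> 1 - t + t * d i < powR (d i) t.
    by move=> d1; exact: line_lt_powR_gt1.
  split; last by apply: eq_means => // i /lt/gt_eqF ->.
  by apply/ge_means => // i; have [/pow1 ->//|/lt/ltW//] := eqVneq (d i) 1.
- have d_le1 : forall i, d i <= 1.
    by move: geAB; rewrite /near_ge {1}AE BE => /(near_le_spectral hA uP d_gt0 one_gt0).
  have line_gt0 i : 0 < 1 - t + t * d i.
    by rewrite lineE ltr_wpDr// mulr_le0 ?subr_le0// ltW.
  have lt i : d i != 1 -> 1 - t + t * d i < powR (d i) t.
    by move=> d1; exact: line_lt_powR_lt0.
  split; last by apply: eq_means => // i /lt/gt_eqF ->.
  by apply/ge_means => // i; have [/pow1 ->//|/lt/ltW//] := eqVneq (d i) 1.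
Qed.
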